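(* Let $f_i(x)=\frac12x^TQ_ix-p_i^Tx+r_i$ for $i=1,\dots,N$, and consider the D-SG iterates $x^{(k+1)}=\mathcal{W}x^{(k)}-\alpha\left[\nabla F(x^{(k)})+w^{(k+1)}\right]$ with additive i.i.d. noise. If $\alpha\in\left(0,\frac{1+\lambda_N^W}{\mu+L}\right]$, then $\xi_k:=x^{(k)}-x^\infty$ satisfies $$\lim_{k\to\infty}\mathrm{Var}(\xi_k)=\alpha^2\frac{\sigma^2}{d}\sum_{i=1}^{Nd}\frac{1}{1-\mu_i^2},$$ where $\mu_1,\dots,\mu_{Nd}$ are the eigenvalues of $\mathcal W-\alpha Q$, and hence $J_\infty(\alpha):=\frac{1}{\sigma^2N}\limsup_{k\to\infty}\mathrm{Var}(x^{(k)})$ is given by $$J_\infty(\alpha)=\alpha^2\frac{1}{Nd}\sum_{i=1}^{Nd}\frac{1}{1-\mu_i^2}.$$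
   Context: Each $Q_i$ is a symmetric $d\times d$ matrix with $\mu I_d\preceq Q_i\preceq LI_d$ ($0<\mu\le L$), $p_i\in\mathbb{R}^d$, $r_i\in\mathbb{R}$. $F(x_1,\dots,x_N)=\sum_{i=1}^Nf_i(x_i)=\frac12x^TQx-p^Tx+r$ on $\mathbb{R}^{Nd}$, with $Q=\mathrm{diag}(Q_1,\dots,Q_N)$ (block diagonal), $p=[p_1^T,\dots,p_N^T]^T$, $r=\sum_ir_i$. Network: $W$ is a symmetric doubly stochastic $N\times N$ matrix associated with a connected undirected graph on $\{1,\dots,N\}$ (for $i\neq j$, $W_{ij}>0$ if $(i,j)$ is an edge and $W_{ij}=0$ otherwise; $W_{ii}>0$), with eigenvalues $1=\lambda_1^W>\lambda_2^W\ge\cdots\ge\lambda_N^W>-1$; $\mathcal W:=W\otimes I_d$. Noise: $w^{(k)}=[(w_1^{(k)})^T,\dots,(w_N^{(k)})^T]^T\in\mathbb{R}^{Nd}$, where the $w_i^{(k)}$ are i.i.d. over all $i$ and $k$ with zero mean and covariance $\frac{\sigma^2}{d}I_d$, $\sigma>0$. $x^{(0)}$ is deterministic. $x^\infty$ is the unique solution of $(I_{Nd}-\mathcal W)x^\infty+\alpha\nabla F(x^\infty)=0$. For a random vector $X$, $\mathrm{Var}(X)=\mathbb{E}\|X-\mathbb{E}X\|^2$ (trace of the covariance matrix). *)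

(* Defs.v *)
From HB Require Import structures.
From mathcomp Require Import all_boot all_order all_algebra.
From mathcomp Require Import finmap.
From mathcomp Require Import all_classical all_reals all_analysis.
From mathcomp Require Export mxtens.

Set Implicit Arguments.
Unset Strict Implicit.
Unset Printing Implicit Defensive.

Import Order.TTheory GRing.Theory Num.Theory.
Import numFieldNormedType.Exports.

Local Open Scope classical_set_scope.
Local Open Scope ring_scope.

Section LinearAlgebra.
Context {R : realType}.

Definition loewner_le n (A B : 'M[R]_n) : Prop :=
  forall v : 'cV[R]_n, 0 <= (v^T *m (B - A) *m v) ord0 ord0.

(* s lists the eigenvalues of A with algebraic multiplicity; for a symmetric A
   such an s exists and is unique up to permutation. *)
Definition eigenvalues_of n (A : 'M[R]_n) (s : n.-tuple R) : Prop :=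
  char_poly A = \prod_(l <- s) ('X - l%:P).

Definition doubly_stochastic n (W : 'M[R]_n) : Prop :=
  [/\ forall i j, 0 <= W i j,
      forall i, \sum_j W i j = 1
    & forall j, \sum_i W i j = 1].

(* Vectors of R^(Nd) are indexed as in the Kronecker product [*t] of mxtens:
   coordinate a of block i sits at mxtens_index (i, a), that is i * d + a. *)
Definition stack N d (y : 'I_N -> 'cV[R]_d) : 'cV[R]_(N * d) :=
  \col_k y (mxtens_unindex k).1 (mxtens_unindex k).2 ord0.

Definition block N d (x : 'cV[R]_(N * d)) (i : 'I_N) : 'cV[R]_d :=
  \col_a x (mxtens_index (i, a)) ord0.

Definition block_diag N d (Q : 'I_N -> 'M[R]_d) : 'M[R]_(N * d) :=
  \matrix_(k, l) (if (mxtens_unindex k).1 == (mxtens_unindex l).1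
    then Q (mxtens_unindex k).1 (mxtens_unindex k).2 (mxtens_unindex l).2
    else 0).

End LinearAlgebra.

Definition weight_matrix_of {R : realType} N (e : rel 'I_N) (W : 'M[R]_N) :
    Prop :=
  [/\ forall i j, i != j -> e i j -> 0 < W i j,
      forall i j, i != j -> ~~ e i j -> W i j = 0
    & forall i, 0 < W i i].

Section Objective.
Context {R : realType}.

Definition quadratic d (Q : 'M[R]_d) (p : 'cV[R]_d) (r : R) (y : 'cV[R]_d) : R :=
  2^-1 * (y^T *m Q *m y) ord0 ord0 - (p^T *m y) ord0 ord0 + r.

Definition separable_sum N d (f : 'I_N -> 'cV[R]_d -> R)
    (x : 'cV[R]_(N * d)) : R :=
  \sum_i f i (block x i).

Definition gradient n (F : 'cV[R]_n -> R) (x : 'cV[R]_n) : 'cV[R]_n :=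
  \col_k 'D_(delta_mx k ord0) F x.

End Objective.

(* Squared Euclidean norm; the library norm on matrices is the sup norm. *)
Definition sqnorm {R : realType} n (v : 'cV[R]_n) : R :=
  \sum_k v k ord0 ^+ 2.

Section Probability.
Context {disp : measure_display} {T : measurableType disp} {R : realType}.
Variable P : probability T R.

Definition mutually_independent (I : choiceType) d' (T' : measurableType d')
    (X : I -> {RV P >-> T'}) : Prop :=
  forall (J : {fset I}) (B : I -> set T'),
    (forall i, i \in J -> measurable (B i)) ->
    P (\bigcap_(i in [set` J]) (X i @^-1` B i)) =
    (\prod_(i <- J) P (X i @^-1` B i))%E.

(* Restricted to measurable B: [distribution] is unspecified on other sets. *)
Definition identically_distributed (I : Type) d' (T' : measurableType d')
    (X : I -> {RV P >-> T'}) : Prop :=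
  forall i j (B : set T'), measurable B ->
    distribution P (X i) B = distribution P (X j) B.

Definition iid (I : choiceType) d' (T' : measurableType d')
    (X : I -> {RV P >-> T'}) : Prop :=
  mutually_independent X /\ identically_distributed X.

Definition has_mean_covariance d (X : T -> d.-tuple R) (m : 'cV[R]_d)
    (C : 'M[R]_d) : Prop :=
  (forall a, 'E_P[fun t => tnth (X t) a] = (m a ord0)%:E)%E /\
  (forall a b, covariance P (fun t => tnth (X t) a) (fun t => tnth (X t) b)
                 = (C a b)%:E).

Definition vmean n (X : T -> 'cV[R]_n) : 'cV[R]_n :=
  \col_k fine 'E_P[fun t => X t k ord0]%E.

Definition vvar n (X : T -> 'cV[R]_n) : \bar R :=
  'E_P[fun t => sqnorm (X t - vmean X)%R]%E.

Definition J_infty N d (sigma : R) (x : nat -> T -> 'cV[R]_(N * d)) : \bar R :=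
  (((sigma ^+ 2 * N%:R)^-1)%:E * limn_esup (fun k => vvar (x k)))%E.

End Probability.

(* Main.v *)
(* The centred iterates satisfy z_(k+1) = A z_k - alpha w_(k+1) with
   A = calW - alpha Q symmetric, so Var(x_K) is alpha^2 sigma^2 / d times
   \sum_(j < K) tr(A^(2 j)) because the noise coordinates are uncorrelated.
   Diagonalising A turns the trace into \sum_m m^(2 j), and the geometric series
   converges: calW <= 1 and Q >= mu bound the eigenvalues of A above by
   1 - alpha mu, while calW >= lam_N, Q <= L and the step size condition bound
   them below by -1 + alpha mu. *)
Require Import Defs.
From HB Require Import structures.
From mathcomp Require Import all_boot all_order all_algebra.
From mathcomp Require Import finmap.
From mathcomp Require Import all_classical all_reals all_analysis.
From mathcomp Require Import measurable_realfun.
From mathcomp Require Import sesquilinear spectral complex.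
From mathcomp Require Import ring lra.

Set Implicit Arguments.
Unset Strict Implicit.
Unset Printing Implicit Defensive.

Import Order.TTheory GRing.Theory Num.Theory.
Import numFieldNormedType.Exports.

Local Open Scope classical_set_scope.
Local Open Scope ring_scope.

(** * Spectral theory of real symmetric matrices, through the complex numbers *)

Lemma conj_diag_mx_exp (F : comUnitRingType) n (P : 'M[F]_n) (D : 'rV[F]_n) k :
  P \in unitmx ->
  (invmx P *m diag_mx D *m P) ^+ k =
    invmx P *m diag_mx (map_mx (fun z => z ^+ k) D) *m P.
Proof.
move=> Pu; elim: k => [|k IH].
  have -> : map_mx (fun z => z ^+ 0) D = const_mx 1.
    by apply/matrixP => i j; rewrite !mxE expr0.
  by rewrite diag_const_mx mulmx1 mulVmx.
have -> : diag_mx (map_mx (fun z => z ^+ k.+1) D) =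
          diag_mx D *m diag_mx (map_mx (fun z => z ^+ k) D).
  rewrite mulmx_diag; congr diag_mx; apply/rowP => i.
  by rewrite !mxE exprS.
by rewrite exprS -[_ * _]/(_ *m _) IH !mulmxA mulmxK.
Qed.

Section Spectral.
Context {R : realType}.
Local Notation toC := (real_complex R).

(** Over the complex numbers a real symmetric matrix is hermitian, hence normal, and the spectral
    theorem for normal matrices applies. *)
Lemma symmetric_spectralP n (A : 'M[R]_n) (P := spectralmx (map_mx toC A)) :
  A^T = A ->
  map_mx toC A = invmx P *m diag_mx (spectral_diag (map_mx toC A)) *m P.
Proof.
move=> sA; apply/orthomx_spectralP/hermitian_normalmx/realsym_hermsym.
  by apply/is_hermitianmxP; rewrite expr0 scale1r map_mx_id// map_trmx sA.
by apply/mxOverP => i j; rewrite mxE complex_real.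
Qed.

(** Similar matrices share their characteristic polynomial, and a product of monic linear factors
    determines its roots up to order. This links the complex diagonalisation to the real list
    [s]. *)
Lemma spectral_diag_eigenvalues n (A : 'M[R]_n) (s : n.-tuple R) :
  A^T = A -> eigenvalues_of A s ->
  perm_eq [seq spectral_diag (map_mx toC A) ord0 i | i <- enum 'I_n]
          [seq toC l | l <- s].
Proof.
move=> sA es.
set D := spectral_diag _; set P := spectralmx (map_mx toC A).
have Pu : P \in unitmx by exact: spectral_unit.
have cD : char_poly (map_mx toC A) = char_poly (diag_mx D).
  have -> : diag_mx D = P *m map_mx toC A *m invmx P.
    by rewrite [in RHS](symmetric_spectralP sA) !mulmxA mulmxV// mul1mx mulmxK.
  rewrite /char_poly.
  (* The scalar matrix of 'X commutes with [P], so conjugation passes to the characteristic matrix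
     and cancels in the determinant. *)
  have -> : char_poly_mx (P *m map_mx toC A *m invmx P) =
            map_mx polyC P *m char_poly_mx (map_mx toC A) *m map_mx polyC (invmx P).
    rewrite /char_poly_mx mulmxBr mulmxBl !map_mxM; congr (_ - _).
    by rewrite scalar_mxC -mulmxA -map_mxM mulmxV// map_mx1 mulmx1.
  rewrite !det_mulmx mulrAC -det_mulmx -map_mxM mulmxV//.
  by rewrite map_mx1 det1 mul1r.
have := cD; rewrite (char_poly_trig (diag_mx_is_trig D)).
rewrite -map_char_poly es rmorph_prod/=.
under eq_bigr do rewrite map_polyXsubC.
under [in RHS]eq_bigr do rewrite mxE eqxx mulr1n.
move=> E; have {}E : \prod_(z <- [seq D ord0 i | i <- enum 'I_n]) ('X - z%:P) =
       \prod_(z <- [seq toC l | l <- s]) ('X - z%:P).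
  by rewrite big_map big_enum/= [RHS]big_map.
by have := E => /prod_XsubC_eq.
Qed.

Lemma mxtrace_exp_eigenvalues n (A : 'M[R]_n) (s : n.-tuple R) k :
  A^T = A -> eigenvalues_of A s -> \tr (A ^+ k) = \sum_(l <- s) l ^+ k.
Proof.
move=> sA es; apply: (@complexI R).
rewrite -[LHS]trace_map_mx rmorph_sum/=.
under eq_bigr do rewrite rmorphXn/=.
rewrite -(big_map toC xpredT (fun z => z ^+ k)).
rewrite -(perm_big _ (spectral_diag_eigenvalues sA es)) big_map big_enum/=.
set D := spectral_diag _.
rewrite [map_mx _ _]rmorphXn/= (symmetric_spectralP sA).
rewrite conj_diag_mx_exp ?spectral_unit//.
rewrite mxtrace_mulC mulmxA mulmxV ?spectral_unit// mul1mx mxtrace_diag.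
by apply: eq_bigr => i _; rewrite mxE.
Qed.

(** In the unitary coordinates $y = Pv$ the form becomes $\sum_i (D_i - c)|y_i|^2$, with each $D_i$
    an element of [s]. *)
Lemma loewner_le_eigenvalues n (A : 'M[R]_n) (s : n.-tuple R) c :
  A^T = A -> eigenvalues_of A s -> (forall l, l \in s -> c <= l) ->
  loewner_le c%:M A.
Proof.
move=> sA es cs v.
rewrite -lecR.
set P := spectralmx (map_mx toC A); set D := spectral_diag (map_mx toC A).
have PU : P \is unitarymx by exact: spectral_unitarymx.
set y := P *m map_mx toC v.
have -> : toC ((v^T *m (A - c%:M) *m v) ord0 ord0) =
    \sum_i (D ord0 i - toC c) * (y i ord0 * (y i ord0)^*).
  have -> : toC ((v^T *m (A - c%:M) *m v) ord0 ord0) =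
     (map_mx toC (v^T *m (A - c%:M) *m v)) ord0 ord0 by rewrite [in RHS]mxE.
  rewrite !map_mxM map_mxB map_scalar_mx/=.
  have -> : map_mx toC A - (toC c)%:M =
      (map_mx Num.conj P^T) *m diag_mx (D - const_mx (toC c)) *m P.
    rewrite linearB/= mulmxBr mulmxBl diag_const_mx mul_mx_scalar -scalemxAl.
    rewrite -invmx_unitary// mulVmx ?spectral_unit// scalemx1.
    by congr (_ - _); exact: symmetric_spectralP.
  (* Since [v] is real, its transpose is its conjugate transpose, so the left factor becomes the
     adjoint of [y]. *)
  have -> : map_mx toC v^T = (map_mx Num.conj (map_mx toC v)^T).
    apply/matrixP => i j; rewrite !mxE; apply/esym/CrealP.
    by rewrite complex_real.
  rewrite !mulmxA -map_mxM -trmx_mul -!mulmxA -/y.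
  rewrite mxE; apply: eq_bigr => i _.
  by rewrite mul_diag_mx !mxE mulrCA; congr (_ * _); rewrite mulrC.
apply: sumr_ge0 => i _; apply: mulr_ge0; last exact: mul_conjC_ge0.
have : D ord0 i \in [seq toC l | l <- s].
  rewrite -(perm_mem (spectral_diag_eigenvalues sA es)).
  by apply/mapP; exists i; rewrite ?mem_enum.
by move=> /mapP[l /cs ? ->]; rewrite subr_ge0 lecR.
Qed.

(** Both forms are evaluated at a row eigenvector [v], where they equal $(l-a)\,vv^T$ and
    $(b-l)\,vv^T$ with $vv^T > 0$. *)
Lemma eigenvalues_bounds n (A : 'M[R]_n) (s : n.-tuple R) a b :
  eigenvalues_of A s -> loewner_le a%:M A -> loewner_le A b%:M ->
  forall l, l \in s -> a <= l <= b.
Proof.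
move=> es Aa Ab l ls.
have : root (char_poly A) l by rewrite es root_prod_XsubC.
rewrite -eigenvalue_root_char => /eigenvalueP[v vA v0].
have vv : 0 < (v *m v^T) ord0 ord0.
  have [j vj] : exists j, v ord0 j != 0.
    apply/existsP; apply: contraNT v0; rewrite negb_exists => /forallP v0.
    by apply/eqP/rowP => j; rewrite [RHS]mxE; apply/eqP/negPn.
  rewrite mxE (bigD1 j)//= ltr_pwDl//.
    by rewrite mxE -expr2 exprn_even_gt0//= vj.
  by rewrite sumr_ge0// => i _; rewrite mxE -expr2 sqr_ge0.
have := Aa v^T; have := Ab v^T; rewrite trmxK !mulmxBr !mulmxBl vA.
rewrite !mul_mx_scalar -!scalemxAl -!scalerBl.
have E c : (c *: (v *m v^T)) ord0 ord0 = c * (v *m v^T) ord0 ord0 by rewrite mxE.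
rewrite !E.
by rewrite !pmulr_lge0// !subr_ge0 => -> ->.
Qed.

End Spectral.

(** * Block structure and the gradient of the quadratic objective *)

Section Gradient.
Context {R : realType}.

Lemma sum_mxtens (V : nmodType) N d (F : 'I_(N * d) -> V) :
  \sum_k F k = \sum_i \sum_a F (mxtens_index (i, a)).
Proof.
rewrite pair_bigA/=.
rewrite (reindex (@mxtens_index N d)); last first.
  exists (@mxtens_unindex N d) => k _; [exact: mxtens_indexK|exact: mxtens_unindexK].
by apply: eq_bigr => -[].
Qed.

Lemma block_diag_form N d (Q : 'I_N -> 'M[R]_d) (x y : 'cV[R]_(N * d)) :
  (x^T *m block_diag Q *m y) ord0 ord0 =
  \sum_i ((block x i)^T *m Q i *m block y i) ord0 ord0.
Proof.
rewrite mxE sum_mxtens; apply: eq_bigr => i _.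
rewrite mxE; apply: eq_bigr => b _; rewrite !mxE; congr (_ * _).
rewrite sum_mxtens (bigD1 i)//= [X in _ + X]big1 ?addr0.
  by apply: eq_bigr => a _; rewrite !mxE !mxtens_indexK/= eqxx.
move=> j ji; apply: big1 => a _; rewrite !mxE !mxtens_indexK/=.
by rewrite (negPf ji) mulr0.
Qed.

Lemma separable_sum_quadratic N d (Q : 'I_N -> 'M[R]_d) (p : 'I_N -> 'cV[R]_d)
    (r : 'I_N -> R) :
  separable_sum (fun i => quadratic (Q i) (p i) (r i)) =
  quadratic (block_diag Q) (stack p) (\sum_i r i).
Proof.
apply/funext => x; rewrite /separable_sum /quadratic !big_split/=.
rewrite block_diag_form mulr_sumr; congr (_ + _ + _).
rewrite sumrN mxE sum_mxtens; congr (- _); apply: eq_bigr => i _.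
by rewrite mxE; apply: eq_bigr => a _; rewrite !mxE mxtens_indexK.
Qed.

Lemma trmx11 (B : 'M[R]_1) : B^T ord0 ord0 = B ord0 ord0.
Proof. by rewrite mxE. Qed.

(** Symmetry of [Q] merges the two cross terms, so the increment along a basis vector is exactly
    $h(Qx-p)_k + h^2Q_{kk}/2$. *)
Lemma gradient_quadratic n (Q : 'M[R]_n) (p : 'cV[R]_n) r x :
  Q^T = Q -> gradient (quadratic Q p r) x = Q *m x - p.
Proof.
move=> sQ; apply/colP => k; rewrite mxE.
set v := delta_mx k ord0.
have vE y : (v^T *m y) ord0 ord0 = y k ord0 by rewrite trmx_delta -rowE mxE.
have Ev h : quadratic Q p r (h *: v + x) - quadratic Q p r x =
   h * ((Q *m x - p) k ord0) + h * h * (2^-1 * Q k k).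
  rewrite /quadratic [(h *: v + x)^T]linearD/= [(h *: v)^T]linearZ/=.
  rewrite !(mulmxDl, mulmxDr) -!(scalemxAl, scalemxAr).
  have E1 : (x^T *m Q *m v) ord0 ord0 = (Q *m x) k ord0.
    by rewrite -trmx11 !trmx_mul trmxK sQ vE.
  have E2 : (v^T *m Q *m x) ord0 ord0 = (Q *m x) k ord0 by rewrite -mulmxA vE.
  have E3 : (p^T *m v) ord0 ord0 = p k ord0.
    by rewrite -trmx11 trmx_mul trmxK vE.
  have E4 : (v^T *m Q *m v) ord0 ord0 = Q k k.
    by rewrite -mulmxA vE /v -colE mxE.
  have E m n' (A B : 'M[R]_(m, n')) i j : (A + B) i j = A i j + B i j by rewrite mxE.
  have S m n' c (A : 'M[R]_(m, n')) i j : (c *: A) i j = c * A i j by rewrite mxE.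
  rewrite !(E, S, E1, E2, E3, E4).
  have -> : (- p) k ord0 = - p k ord0 by rewrite mxE.
  by field.
rewrite /derive; apply/cvg_lim => //.
have -> : (fun h => h^-1 *: ((quadratic Q p r \o shift x) (h *: v) - quadratic Q p r x))
   = (fun h => h^-1 * (h * ((Q *m x - p) k ord0) + h * h * (2^-1 * Q k k))).
  by apply/funext => h /=; rewrite Ev.
(* The factor [h] cancels only for nonzero [h], so the two quotients agree on a punctured
   neighbourhood of 0. *)
apply: (@cvg_trans _ ((fun h : R => (Q *m x - p) k ord0 + h * (2^-1 * Q k k)) @ 0^')).
  apply: near_eq_cvg; near=> h.
  have h0 : h != 0 by near: h; exact: nbhs_dnbhs_neq.
  by field.
have h0 : (h : R) @[h --> 0^'] --> (0 : R) by exact: nbhs_dnbhs.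
have := cvgD (cvg_cst ((Q *m x - p) k ord0)) (cvgM h0 (cvg_cst (2^-1 * Q k k))).
rewrite mul0r addr0; apply.
Unshelve. all: by end_near. Qed.

End Gradient.

(** * Expectation of a product of independent variables *)

Section Independence.
Context d (T : measurableType d) (R : realType) (P : probability T R).

(** Independence makes the joint law of [(X, Y)] the product of the two laws, and Fubini splits the
    integral. Square integrability makes [X], [Y] and their product integrable. *)
Lemma expectation_mul_independent (X Y : {RV P >-> R}) :
  (forall A B, measurable A -> measurable B ->
     P (X @^-1` A `&` Y @^-1` B) = (P (X @^-1` A) * P (Y @^-1` B))%E) ->
  (X : T -> R) \in Lfun P 2%:E -> (Y : T -> R) \in Lfun P 2%:E ->
  ('E_P[fun t => (X t * Y t)%R] = 'E_P[X] * 'E_P[Y])%E.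
Proof.
move=> XY X2 Y2.
have Pfin : P [set: T] \is a fin_num by exact: fin_num_measure.
have X1 := Lfun_subset12 Pfin X2; have Y1 := Lfun_subset12 Pfin Y2.
have XY1 := Lfun2_mul_Lfun1 X2 Y2.
have mXY : measurable_fun setT (fun t => (X t, Y t)) by exact: measurable_fun_pair.
pose f (z : R * R) : \bar R := (z.1 * z.2)%:E.
have mf : measurable_fun [set: R * R] f.
  by apply/measurable_EFinP; exact: measurable_funM.
have iXY : P.-integrable setT (f \o (fun t => (X t, Y t))).
  exact/Lfun1_integrable.
pose mX := distribution P X; pose mY := distribution P Y.
pose m := pushforward P (fun t => (X t, Y t)).
(* The hypothesis gives agreement on rectangles; uniqueness of the product measure extends it to all
   measurable sets. *)
have mE : forall C, measurable C -> (mX \x mY)%E C = m C.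
  apply: product_measure_unique => A B mA mB.
  rewrite -XY//.
have imf : (mX \x mY)%E.-integrable setT f.
  apply/integrableP; split => //.
  rewrite (eq_measure_integral m); last by move=> C mC _; exact: mE.
  by have /integrableP[] := integrable_pushforward mXY mf iXY measurableT.
have -> : ('E_P[fun t => (X t * Y t)%R] = \int[mX \x mY]_z f z)%E.
  rewrite unlock (eq_measure_integral m); last by move=> C mC _; exact: mE.
  by rewrite (integral_pushforward mXY mf iXY measurableT).
have EY : (\int[mY]_y y%:E = 'E_P[Y])%E.
  rewrite (integral_distribution (X := Y) (f := EFin)).
  - by rewrite unlock.
  - exact: EFin_measurable.
  - exact/Lfun1_integrable.
have EX : (\int[mX]_x x%:E = 'E_P[X])%E.
  rewrite (integral_distribution (X := X) (f := EFin)).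
  - by rewrite unlock.
  - exact: EFin_measurable.
  - exact/Lfun1_integrable.
have iX : mX.-integrable setT EFin.
  apply: integrable_pushforward => //.
  exact/Lfun1_integrable.
have iY : mY.-integrable setT EFin.
  apply: integrable_pushforward => //.
  exact/Lfun1_integrable.
rewrite -(integral12_prod_meas1 imf) /fubini_F/= /f/=.
have EYfin := expectation_fin_num Y1.
transitivity (\int[mX]_x (x%:E * 'E_P[Y]))%E.
  apply: eq_integral => x _.
  under eq_integral do rewrite EFinM.
  by rewrite integralZl// EY.
by rewrite -(fineK EYfin) integralZr// EX.
Qed.

End Independence.

(** * Loewner bounds and the location of the eigenvalues of the iteration matrix *)

Section Loewner.
Context {R : realType}.

Lemma loewner_leD n (A B C D : 'M[R]_n) :
  loewner_le A B -> loewner_le C D -> loewner_le (A + C) (B + D).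
Proof.
move=> AB CD v; rewrite opprD addrACA mulmxDr mulmxDl mxE.
by rewrite addr_ge0.
Qed.

Lemma loewner_leN n (A B : 'M[R]_n) : loewner_le A B -> loewner_le (- B) (- A).
Proof. by move=> AB v; rewrite opprK addrC. Qed.

Lemma loewner_leZ n (A B : 'M[R]_n) c :
  0 <= c -> loewner_le A B -> loewner_le (c *: A) (c *: B).
Proof.
move=> c0 AB v; rewrite -scalerBr -scalemxAr -scalemxAl mxE.
by rewrite mulr_ge0.
Qed.

(** $A\otimes I_d$ does not mix the [d] coordinates, so the form splits into one copy of the form of
    [A] per coordinate [a]. *)
Lemma tens1_form N d (A : 'M[R]_N) (v : 'cV[R]_(N * d)) :
  (v^T *m (A *t (1%:M : 'M[R]_d)) *m v) ord0 ord0 =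
    \sum_a ((\col_i v (mxtens_index (i, a)) ord0)^T *m A *m
       (\col_i v (mxtens_index (i, a)) ord0)) ord0 ord0.
Proof.
rewrite mxE sum_mxtens exchange_big/=; apply: eq_bigr => a _.
rewrite mxE; apply: eq_bigr => i _; rewrite !mxE; congr (_ * _).
rewrite sum_mxtens; apply: eq_bigr => j _.
rewrite (bigD1 a)//= [X in _ + X]big1 ?addr0.
  by rewrite !mxE !mxtens_indexK/= eqxx mulr1.
by move=> b ba; rewrite !mxE !mxtens_indexK/= (negPf ba) !mulr0.
Qed.

Lemma loewner_le_tens1 N d (A B : 'M[R]_N) :
  loewner_le A B -> loewner_le (A *t (1%:M : 'M[R]_d)) (B *t (1%:M : 'M[R]_d)).
Proof.
move=> AB v.
have -> : B *t (1%:M : 'M[R]_d) - A *t (1%:M : 'M[R]_d) = (B - A) *t (1%:M : 'M[R]_d).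
  by apply/matrixP => i j; rewrite !mxE mulrBl.
by rewrite tens1_form sumr_ge0.
Qed.

Lemma scalar_tens1 N d (c : R) :
  (c%:M : 'M[R]_N) *t (1%:M : 'M[R]_d) = c%:M :> 'M[R]_(N * d).
Proof.
apply/matrixP => k l.
rewrite -(mxtens_unindexK k) -(mxtens_unindexK l) tensmxE !mxE.
rewrite (can_eq (@mxtens_indexK N d)) xpair_eqE.
by case: eqP; case: eqP; rewrite ?mulr1 ?mulr0 ?mul0r.
Qed.

Lemma block_diag_scalar N d (c : R) :
  block_diag (fun _ : 'I_N => c%:M : 'M[R]_d) = c%:M.
Proof.
apply/matrixP => k l.
rewrite -[in RHS](mxtens_unindexK k) -[in RHS](mxtens_unindexK l) !mxE.
rewrite (can_eq (@mxtens_indexK N d)) [_ == _ in RHS]xpair_eqE.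
by case: eqP.
Qed.

Lemma loewner_le_block_diag N d (A B : 'I_N -> 'M[R]_d) :
  (forall i, loewner_le (A i) (B i)) ->
  loewner_le (block_diag A) (block_diag B).
Proof.
move=> AB v.
have -> : block_diag B - block_diag A = block_diag (fun i => B i - A i).
  by apply/matrixP => k l; rewrite !mxE; case: ifP; rewrite ?subr0// !mxE.
by rewrite block_diag_form sumr_ge0// => i _; exact: AB.
Qed.

(* v^T (I - W) v = 1/2 \sum_(i, j) W_ij (v_i - v_j)^2 *)
Lemma loewner_le_doubly_stochastic n (W : 'M[R]_n) :
  doubly_stochastic W -> loewner_le W 1%:M.
Proof.
move=> [W0 Wr Wc] v.
rewrite mulmxBr mulmxBl mulmx1.
have E (A B : 'M[R]_1) : (A - B) ord0 ord0 = A ord0 ord0 - B ord0 ord0.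
  by rewrite !mxE.
rewrite E.
(* Unit row sums handle the terms in $v_i^2$, unit column sums those in $v_j^2$. *)
have -> : (v^T *m v) ord0 ord0 =
    2^-1 * (\sum_i \sum_j W i j * (v i ord0 ^+ 2 + v j ord0 ^+ 2)).
  under [in RHS]eq_bigr do (under eq_bigr do rewrite mulrDr; rewrite big_split/=).
  rewrite big_split/= [X in _ + X]exchange_big/=.
  under eq_bigr do rewrite -mulr_suml Wr mul1r.
  under [X in _ + X]eq_bigr do rewrite -mulr_suml Wc mul1r.
  have -> : (v^T *m v) ord0 ord0 = \sum_i v i ord0 ^+ 2.
    by rewrite mxE; apply: eq_bigr => i _; rewrite mxE expr2.
  by field.
have -> : (v^T *m W *m v) ord0 ord0 =
    2^-1 * (\sum_i \sum_j W i j * (2 * v i ord0 * v j ord0)).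
  rewrite mxE [in RHS]exchange_big mulr_sumr/=; apply: eq_bigr => j _.
  by rewrite !mxE mulr_suml mulr_sumr; apply: eq_bigr => i _; rewrite mxE; field.
rewrite -mulrBr -sumrB mulr_ge0// sumr_ge0// => i _.
rewrite -sumrB sumr_ge0// => j _.
rewrite -mulrBr mulr_ge0//.
have -> : v i ord0 ^+ 2 + v j ord0 ^+ 2 - 2 * v i ord0 * v j ord0 =
   (v i ord0 - v j ord0) ^+ 2 by ring.
exact: sqr_ge0.
Qed.

Lemma sorted_last_le (n : nat) (s : n.-tuple R) l :
  sorted >=%R s -> l \in s -> s`_n.-1 <= l.
Proof.
move=> ss /(nthP 0)[i + <-]; rewrite size_tuple => ni.
(* Membership rules out the empty list, so [n.-1] is a genuine index and the default value 0 of the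
   lookup never appears. *)
have n0 : (0 < n)%N by exact: leq_ltn_trans ni.
apply: (sorted_leq_nth (leT := >=%R)) => //.
- by move=> a b c /= ab bc; exact: le_trans bc ab.
- by move=> a /=.
- by rewrite inE size_tuple.
- by rewrite inE size_tuple prednK.
- by rewrite -ltnS prednK.
Qed.

Lemma trmx_block_diag N d (Q : 'I_N -> 'M[R]_d) :
  (forall i, (Q i)^T = Q i) -> (block_diag Q)^T = block_diag Q.
Proof.
move=> sQ; apply/matrixP => k l; rewrite !mxE eq_sym; case: eqP => // ->.
by rewrite -[in LHS]sQ mxE.
Qed.

Lemma dsg_eigenvalues_lt1 N d (mu L : R) (Q : 'I_N -> 'M[R]_d) (W : 'M[R]_N)
    (lam : N.-tuple R) (alpha : R) (mus : (N * d).-tuple R) :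
  0 < mu -> 0 < mu + L ->
  (forall i, loewner_le mu%:M (Q i)) -> (forall i, loewner_le (Q i) L%:M) ->
  W^T = W -> doubly_stochastic W ->
  eigenvalues_of W lam -> sorted >=%R lam ->
  0 < alpha -> alpha <= (1 + lam`_N.-1) / (mu + L) ->
  eigenvalues_of (W *t (1%:M : 'M[R]_d) - alpha *: block_diag Q) mus ->
  forall m, m \in mus -> `|m| < 1.
Proof.
move=> mu0 muL Qmu QL sW dsW elam slam alpha0 alphale emus m mmus.
have WL : loewner_le (lam`_N.-1)%:M W.
  by apply: (loewner_le_eigenvalues sW elam) => l; exact: sorted_last_le.
have lo : loewner_le (lam`_N.-1 - alpha * L)%:M
    (W *t (1%:M : 'M[R]_d) - alpha *: block_diag Q).
  (* The scalar bound is rewritten as a Kronecker product minus a block diagonal matrix, to be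
     compared with [A] summand by summand. *)
  rewrite raddfB/= -scale_scalar_mx -(scalar_tens1 N d) -(block_diag_scalar N d).
  apply: loewner_leD; first exact: loewner_le_tens1.
  by apply/loewner_leN/loewner_leZ; [exact: ltW|exact: loewner_le_block_diag].
have hi : loewner_le (W *t (1%:M : 'M[R]_d) - alpha *: block_diag Q)
    (1 - alpha * mu)%:M.
  rewrite raddfB/= -scale_scalar_mx -(scalar_tens1 N d 1) -(block_diag_scalar N d).
  apply: loewner_leD.
    exact/loewner_le_tens1/loewner_le_doubly_stochastic.
  by apply/loewner_leN/loewner_leZ; [exact: ltW|exact: loewner_le_block_diag].
have /andP[mlo mhi] := eigenvalues_bounds emus lo hi mmus.
(* The step size condition becomes $\alpha(\mu+L)\le 1+\lambda_N^W$, so the lower bound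
   $\lambda_N^W-\alpha L$ is at least $-1+\alpha\mu$. *)
move: alphale; rewrite ler_pdivlMr// => alphale.
have am : 0 < alpha * mu by exact: mulr_gt0.
rewrite ltr_norml; apply/andP; split; lra.
Qed.

End Loewner.

(** * Variance of affine images of uncorrelated variables *)

Section Variance.
Context d (T : measurableType d) (R : realType) (P : probability T R).

(** The expectation lives in the extended reals, so equality with a real [c] already says that the
    $L^2$ norm is finite. *)
Lemma Lfun2_expectation_sqr (X : T -> R) c :
  measurable_fun setT X -> ('E_P[fun t => (X t * X t)%R] = c%:E)%E ->
  X \in Lfun P 2%:E.
Proof.
move=> mX Ec; rewrite inE; apply/andP; split; rewrite inE//=.
rewrite /finite_norm unlock/=.
have -> : (\int[P]_x (`|(X x)%:E| `^ 2) = c%:E)%E.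
  rewrite -Ec unlock; apply: eq_integral => t _.
  by rewrite abse_EFin poweR_EFin powR_mulrn// -normrX ger0_norm ?sqr_ge0.
by rewrite poweR_EFin ltry.
Qed.

Lemma expectation_linear_combination (I : finType) (b : I -> R) (f : I -> T -> R) :
  (forall i, f i \in Lfun P 1) ->
  ('E_P[fun t => (\sum_i b i * f i t)%R] = (\sum_i b i * fine 'E_P[f i])%R%:E)%E.
Proof.
move=> f1.
have fi i : P.-integrable setT (EFin \o f i) by exact/Lfun1_integrable.
rewrite unlock.
under eq_integral do rewrite -sumEFin.
rewrite integral_sum//; last first.
  by move=> i; apply: (integrableZl measurableT (b i) (fi i)).
rewrite -sumEFin; apply: eq_bigr => i _.
transitivity (\int[P]_x ((b i)%:E * (EFin \o f i) x))%E => //.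
rewrite (integralZl measurableT (fi i)) EFinM fineK//.
by have := expectation_fin_num (f1 i); rewrite unlock.
Qed.

(** The mean is [c], so the deviation is the random sum alone. Expanding its square over pairs of
    indices leaves only the diagonal, [s *+ (i == j)] being [s] times the Kronecker delta. *)
Lemma vvar_uncorrelated (I : finType) n (Y : I -> T -> R) (B : 'I_n -> I -> R)
    (c : 'cV[R]_n) (s : R) :
  (forall i, Y i \in Lfun P 2%:E) -> (forall i, 'E_P[Y i]%E = 0%E) ->
  (forall i j, 'E_P[fun t => (Y i t * Y j t)%R]%E = (s *+ (i == j))%:E) ->
  vvar P (fun t => c + \col_k \sum_i B k i * Y i t) =
    (s * \sum_k \sum_i B k i ^+ 2)%:E.
Proof.
move=> Y2 Y0 YY.
have Pfin : P [set: T] \is a fin_num by exact: fin_num_measure.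
have Y1 i := Lfun_subset12 Pfin (Y2 i).
have -> : vvar P (fun t => c + \col_k \sum_i B k i * Y i t) =
    'E_P[fun t => (\sum_k (\sum_i B k i * Y i t) ^+ 2)%R]%E.
  rewrite /vvar; congr expectation; apply/funext => t.
  rewrite /sqnorm; apply: eq_bigr => k _; congr (_ ^+ 2).
  rewrite !mxE.
  suff -> : 'E_P[fun t => ((c + \col_k \sum_i B k i * Y i t) k ord0)%R]%E = (c k ord0)%:E.
    by rewrite /= addrC addKr.
  have -> : (fun t => (c + \col_k \sum_i B k i * Y i t) k ord0) =
     cst (c k ord0) \+ (fun t => \sum_i B k i * Y i t).
    by apply/funext => u; rewrite !mxE.
  rewrite expectationD ?Lfun_cst//; last first.
    have -> : (fun t => \sum_i B k i * Y i t) = \sum_i (B k i *: Y i).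
      by apply/funext => u; rewrite fct_sumE.
    by rewrite rpred_sum// => i _; rewrite rpredZ.
  rewrite expectation_cst expectation_linear_combination//.
  by rewrite big1 ?adde0// => i _; rewrite Y0 mulr0.
(* Collecting the sum over [k] into deterministic coefficients exhibits a linear combination of the
   products of pairs. *)
have -> : (fun t => \sum_k (\sum_i B k i * Y i t) ^+ 2) =
    (fun t => \sum_(p : I * I) (\sum_k B k p.1 * B k p.2) * (Y p.1 t * Y p.2 t)).
  apply/funext => t; under [RHS]eq_bigr do rewrite mulr_suml.
  rewrite [RHS]exchange_big/=; apply: eq_bigr => k _.
  transitivity (\sum_i \sum_j B k i * B k j * (Y i t * Y j t)); last first.
    by rewrite pair_bigA.
  rewrite expr2 mulr_suml; apply: eq_bigr => i _; rewrite mulr_sumr; apply: eq_bigr => j _.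
  by rewrite mulrACA.
rewrite (@expectation_linear_combination _ _ (fun p t => Y p.1 t * Y p.2 t)); last first.
  by move=> p; exact: Lfun2_mul_Lfun1.
congr EFin; rewrite exchange_big/= mulr_sumr.
rewrite -(pair_bigA _ (fun i j => (\sum_k B k i * B k j) *
   fine 'E_P[fun t => (Y i t * Y j t)%R]%E))/=.
apply: eq_bigr => i _; rewrite (bigD1 i)//= [X in _ + X]big1 ?addr0.
  by rewrite YY eqxx mulr1n mulrC; congr (_ * _).
by move=> j ji; rewrite YY eq_sym (negPf ji) mulr0n mulr0.
Qed.

End Variance.

(** * Second moments of the noise coordinates *)

Section IidNoise.
Context disp (T : measurableType disp) (R : realType) (P : probability T R).

Lemma mutually_independent_pair (I : choiceType) d' (T' : measurableType d')
    (X : I -> {RV P >-> T'}) i j (A B : set T') :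
  mutually_independent X -> i != j -> measurable A -> measurable B ->
  (P (X i @^-1` A `&` X j @^-1` B) = P (X i @^-1` A) * P (X j @^-1` B))%E.
Proof.
move=> indep ij mA mB.
have ji : (j == i) = false by rewrite eq_sym; exact: negbTE.
have := indep [fset i; j]%fset (fun k => if k == i then A else B).
rewrite big_fsetU1 ?inE//= big_seq_fset1 eqxx ji => <-; last first.
  by move=> k _; case: ifP.
congr (P _); apply/seteqP; split => t /=.
  move=> [Ai Bj] k /=; rewrite !inE => /orP[]/eqP->; rewrite ?eqxx ?ji//.
by move=> H; split; [have := H i|have := H j];
  rewrite /= !inE eqxx ?orbT ?ji; exact.
Qed.

Lemma has_mean_covariance_Lfun2 d (X : {RV P >-> d.-tuple R}) (C : 'M[R]_d) a :
  has_mean_covariance P X 0 C -> (fun t => tnth (X t) a) \in Lfun P 2%:E.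
Proof.
move=> [X0 XC]; apply: (@Lfun2_expectation_sqr _ _ _ _ _ (C a a)).
  exact: measurableT_comp (measurable_tnth a) _.
rewrite -XC covariance.unlock X0 mxE/=; congr expectation; apply/funext => t /=.
by rewrite [RHS]/GRing.mul/= !subr0.
Qed.

(** Coordinates of one noise vector are handled by its covariance, which makes them uncorrelated but
    possibly dependent; coordinates of distinct vectors are independent with zero mean. *)
Lemma independent_noise_expectation_mul (N d : nat) (s : R)
    (w : nat -> 'I_N -> {RV P >-> d.-tuple R}) k l i j a b :
  mutually_independent (fun ki : nat * 'I_N => w ki.1 ki.2) ->
  (forall k i, has_mean_covariance P (w k i) 0 s%:M) ->
  ('E_P[fun t => (tnth (w k i t) a * tnth (w l j t) b)%R] =
    (s *+ ((k, (i, a)) == (l, (j, b))))%:E)%E.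
Proof.
move=> indep wm.
have [[-> ->]|ne] := eqVneq (k, i) (l, j).
  have [w0 wC] := wm l j.
  transitivity ((s%:M : 'M[R]_d) a b)%:E; last first.
    by rewrite mxE !xpair_eqE !eqxx.
  rewrite -wC covariance.unlock !w0 !mxE/=; congr expectation; apply/funext => t /=.
  by rewrite [RHS]/GRing.mul/= !subr0.
have -> : ((k, (i, a)) == (l, (j, b))) = false.
  by apply/negbTE; apply: contra ne; rewrite !xpair_eqE => /and3P[-> ->].
have mw k' i' a' : measurable_fun setT (fun t => tnth (w k' i' t) a').
  exact: measurableT_comp (measurable_tnth a') _.
pose X : {RV P >-> R} := HB.pack (fun t => tnth (w k i t) a)
  (isMeasurableFun.Build _ _ _ _ _ (mw k i a)).
pose Y : {RV P >-> R} := HB.pack (fun t => tnth (w l j t) b)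
  (isMeasurableFun.Build _ _ _ _ _ (mw l j b)).
rewrite (@expectation_mul_independent _ _ _ _ X Y).
- by rewrite (wm k i).1 mxE mul0e.
- move=> A B mA mB.
  (* Events on a coordinate are pulled back along the projection to events on the whole vector,
     where independence is assumed. *)
  pose tn (c : 'I_d) (u : d.-tuple R) := tnth u c.
  have mt c (C : set R) : measurable C -> measurable (tn c @^-1` C).
    by move=> mC; rewrite -[X in measurable X]setTI; exact: measurable_tnth.
  exact: (mutually_independent_pair indep ne (mt a _ mA) (mt b _ mB)).
- exact: has_mean_covariance_Lfun2 (wm k i).
- exact: has_mean_covariance_Lfun2 (wm l j).
Qed.

End IidNoise.

(** * Unrolling an affine recursion driven by noise *)

Section AffineRecursion.
Context {R : realType}.

(** [x0] and [b] contribute only the deterministic [c], left existential because the variance does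
    not see it. As [g j] enters at step [j.+1], it is then multiplied by [A] a further [K - j.+1]
    times. *)
Lemma affine_recursion_unroll T n (A : 'M[R]_n) (b x0 : 'cV[R]_n) alpha
    (g x : nat -> T -> 'cV[R]_n) :
  (forall t, x 0 t = x0) ->
  (forall k t, x k.+1 t = A *m x k t + b - alpha *: g k t) ->
  forall K, exists c, forall t,
    x K t = c - alpha *: \sum_(j < K) A ^+ (K - j.+1) *m g j t.
Proof.
move=> xx0 xS; elim=> [|K [c IH]].
  by exists x0 => t; rewrite big_ord0 scaler0 subr0.
exists (A *m c + b) => t; rewrite xS IH big_ord_recr/= subnn expr0 mul1mx.
rewrite scalerDr opprD addrA; congr (_ - _).
rewrite mulmxBr -scalemxAr mulmx_sumr addrAC; congr (_ - _ *: _).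
apply: eq_bigr => j _; rewrite mulmxA; congr (_ *m _).
by rewrite subSn// exprS.
Qed.

Lemma trmx_exp_sym n (A : 'M[R]_n) k : A^T = A -> (A ^+ k)^T = A ^+ k.
Proof.
move=> sA; elim: k => [|k IH]; first by rewrite expr0 trmx1.
by rewrite {1}exprS -[_ * _]/(_ *m _) trmx_mul IH sA exprSr.
Qed.

(** This is the squared Frobenius norm $\mathrm{tr}(B^TB)$. *)
Lemma sum_sqr_entries_sym n (B : 'M[R]_n) :
  B^T = B -> \sum_i \sum_j B i j ^+ 2 = \tr (B ^+ 2).
Proof.
move=> sB; rewrite /mxtrace; apply: eq_bigr => i _.
rewrite expr2 -[_ * _]/(_ *m _) mxE; apply: eq_bigr => j _.
by rewrite expr2 -[in X in _ * X]sB mxE.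
Qed.

End AffineRecursion.

(** * Exact variance of the iterates at finite time *)

Section Iterates.
Context disp (T : measurableType disp) (R : realType) (P : probability T R).

(** The shift [e] is arbitrary, so that one formula covers both $\xi_k$ and $x^{(k)}$. *)
Lemma vvar_affine_recursion N d (A : 'M[R]_(N * d)) (mus : (N * d).-tuple R)
    (b x0 e : 'cV[R]_(N * d)) alpha s (w : nat -> 'I_N -> {RV P >-> d.-tuple R})
    (x : nat -> T -> 'cV[R]_(N * d)) :
  A^T = A -> eigenvalues_of A mus ->
  mutually_independent (fun ki : nat * 'I_N => w ki.1 ki.2) ->
  (forall k i, has_mean_covariance P (w k i) 0 s%:M) ->
  (forall t, x 0 t = x0) ->
  (forall k t, x k.+1 t = A *m x k t + b
     - alpha *: stack (fun i => \col_a tnth (w k i t) a)) ->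
  forall K, vvar P (fun t => x K t - e) =
    (alpha ^+ 2 * s * \sum_(m <- mus) series (geometric 1 (m ^+ 2)) K)%:E.
Proof.
move=> sA emus indep wm xx0 xS K.
have [c xK] := affine_recursion_unroll xx0 xS K.
pose Y (q : 'I_K * 'I_(N * d)) t : R :=
  tnth (w q.1 (mxtens_unindex q.2).1 t) (mxtens_unindex q.2).2.
pose B k (q : 'I_K * 'I_(N * d)) := - alpha * (A ^+ (K - q.1.+1)) k q.2.
have -> : (fun t => x K t - e) = (fun t => (c - e) + \col_k \sum_q B k q * Y q t).
  apply/funext => t; rewrite xK addrAC; congr (_ + _).
  apply/colP => k; rewrite !mxE summxE.
  transitivity (\sum_j \sum_l B k (j, l) * Y (j, l) t); last by rewrite pair_bigA.
  rewrite mulr_sumr -sumrN; apply: eq_bigr => j _.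
  rewrite mxE mulr_sumr -sumrN; apply: eq_bigr => l _.
  by rewrite /B /Y !mxE/= mulrA !mulNr.
rewrite (@vvar_uncorrelated _ _ _ _ _ _ _ _ _ s).
- rewrite [alpha ^+ 2 * s]mulrC -mulrA; congr (s * _)%:E.
  transitivity (\sum_(j < K) alpha ^+ 2 * \sum_k \sum_l (A ^+ (K - j.+1)) k l ^+ 2).
    under [RHS]eq_bigr do rewrite mulr_sumr.
    rewrite [RHS]exchange_big/=; apply: eq_bigr => k _.
    transitivity (\sum_j \sum_l B k (j, l) ^+ 2); first by rewrite pair_bigA.
    apply: eq_bigr => j _; rewrite mulr_sumr; apply: eq_bigr => l _.
    by rewrite /B exprMn sqrrN.
  rewrite -mulr_sumr; congr (_ * _).
  (* Reversing time turns the exponent [K - j.+1] into [j], matching the partial sum with [K] terms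
     of the geometric series of ratio [m ^+ 2]. *)
  rewrite (reindex_inj rev_ord_inj)/=.
  rewrite /series/=; under [RHS]eq_bigr do rewrite big_mkord.
  rewrite [RHS]exchange_big/=; apply: eq_bigr => j _.
  rewrite subnSK// subKn; last exact: ltnW.
  rewrite sum_sqr_entries_sym ?trmx_exp_sym// -exprM (mulnC j).
  rewrite (mxtrace_exp_eigenvalues _ sA emus); apply: eq_bigr => m _.
  by rewrite /geometric/= mul1r exprM.
- by move=> q; exact: has_mean_covariance_Lfun2 (wm _ _).
- by move=> q; rewrite /Y (wm _ _).1 mxE.
- move=> [j k] [l m]; rewrite /Y/= (independent_noise_expectation_mul _ _ _ _ _ _ indep wm).
  congr (s *+ _)%:E; rewrite !xpair_eqE; congr (nat_of_bool (_ && _)).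
  (* Splitting a stacked index into agent and coordinate is injective, so both Kronecker deltas
     agree. *)
  by rewrite -(can_eq (@mxtens_unindexK N d)).
Qed.

End Iterates.

Theorem theorem33 (R : realType) (disp : measure_display)
  (T : measurableType disp) (P : probability T R)
  (N d : nat) (N_gt0 : (0 < N)%N) (d_gt0 : (0 < d)%N)
  (mu L : R) (mu_gt0 : 0 < mu) (le_mu_L : mu <= L)
  (Q : 'I_N -> 'M[R]_d) (p : 'I_N -> 'cV[R]_d) (r : 'I_N -> R)
  (Q_sym : forall i, (Q i)^T = Q i)
  (Q_ge : forall i, loewner_le mu%:M (Q i))
  (Q_le : forall i, loewner_le (Q i) L%:M)
  (e : rel 'I_N) (e_irr : irreflexive e) (e_sym : symmetric e)
  (e_conn : forall i j, connect e i j)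
  (W : 'M[R]_N) (W_sym : W^T = W) (W_ds : doubly_stochastic W)
  (W_graph : weight_matrix_of e W)
  (lam : N.-tuple R) (lam_eig : eigenvalues_of W lam)
  (lam_sorted : sorted >=%R lam)
  (* w k i is the noise of agent i entering the iterate of index k + 1 *)
  (sigma : R) (sigma_gt0 : 0 < sigma)
  (w : nat -> 'I_N -> {RV P >-> d.-tuple R})
  (w_iid : iid (fun ki : nat * 'I_N => w ki.1 ki.2))
  (w_moments : forall k i,
     has_mean_covariance P (w k i) 0 (sigma ^+ 2 / d%:R)%:M)
  (alpha : R) (alpha_gt0 : 0 < alpha)
  (alpha_le : alpha <= (1 + lam`_N.-1) / (mu + L))
  (x0 : 'cV[R]_(N * d)) (x : nat -> T -> 'cV[R]_(N * d))
  (xinf : 'cV[R]_(N * d)) (mus : (N * d).-tuple R) :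
  let calW := W *t (1%:M : 'M[R]_d) in
  let gradF := gradient (separable_sum (fun i => quadratic (Q i) (p i) (r i))) in
  (forall t, x 0%N t = x0) ->
  (forall k t, x k.+1 t =
     calW *m x k t
     - alpha *: (gradF (x k t) + stack (fun i => \col_a tnth (w k i t) a))) ->
  (1%:M - calW) *m xinf + alpha *: gradF xinf = 0 ->
  eigenvalues_of (calW - alpha *: block_diag Q) mus ->
  (vvar P (fun t => x k t - xinf) @[k --> \oo] -->
     (alpha ^+ 2 * (sigma ^+ 2 / d%:R) * \sum_(m <- mus) (1 / (1 - m ^+ 2)))%:E)
  /\
  J_infty P sigma x =
    (alpha ^+ 2 * (1 / (N * d)%:R) * \sum_(m <- mus) (1 / (1 - m ^+ 2)))%:E.
Proof.
move=> calW gradF xx0 xS _ emus.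
set A := calW - alpha *: block_diag Q in emus.
have sQ : (block_diag Q)^T = block_diag Q by exact: trmx_block_diag.
have sA : A^T = A.
  by rewrite /A linearB/= linearZ/= sQ /calW trmx_tens W_sym trmx1.
have gradE y : gradF y = block_diag Q *m y - stack p.
  by rewrite /gradF separable_sum_quadratic gradient_quadratic.
(* The gradient is affine, so its linear part joins [calW] to form [A] and the rest is the constant
   drift [alpha *: stack p]. *)
have xS' k t : x k.+1 t = A *m x k t + alpha *: stack p
     - alpha *: stack (fun i => \col_a tnth (w k i t) a).
  by rewrite xS gradE /A mulmxBl -scalemxAl !scalerDr scalerN
    !opprD opprK !addrA.
have varE e0 := vvar_affine_recursion e0 sA emus w_iid.1 w_moments xx0 xS'.
have mus_lt1 : forall m, m \in mus -> `|m| < 1.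
  apply: (dsg_eigenvalues_lt1 mu_gt0 _ Q_ge Q_le W_sym W_ds lam_eig lam_sorted
    alpha_gt0 alpha_le emus).
  by rewrite addr_gt0// (lt_le_trans mu_gt0).
set S := \sum_(m <- mus) (1 / (1 - m ^+ 2)).
have cvgS : \sum_(m <- mus) series (geometric 1 (m ^+ 2)) K @[K --> \oo] --> S.
  (* Restricting the sums to members of [mus] makes $|m|<1$ available for each term, whose geometric
     series then converges. *)
  rewrite /S big_seq; under eq_fun do rewrite big_seq.
  apply: cvg_big => [|m /mus_lt1 m1]; first exact: add_continuous.
  apply: cvg_geometric_series; rewrite normrX.
  by rewrite expr_lt1.
have cvgV e0 : vvar P (fun t => x k t - e0) @[k --> \oo] -->
    (alpha ^+ 2 * (sigma ^+ 2 / d%:R) * S)%:E.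
  under eq_fun do rewrite varE.
  by apply: cvg_EFin; [exact: nearW|apply: cvgM cvgS; exact: cvg_cst].
split; first exact: cvgV.
(* With shift 0 the same limit holds for $\mathrm{Var}(x^{(k)})$, and the upper limit of a
   convergent sequence is its limit. *)
have := cvgV 0; under eq_fun do under eq_fun do rewrite subr0.
move=> cV; rewrite /J_infty is_cvg_limn_esupE; last by apply/cvg_ex; eexists; exact: cV.
rewrite (cvg_lim _ cV)// -EFinM; congr EFin.
have s0 : sigma != 0 by rewrite gt_eqF.
have N0 : N%:R != 0 :> R by rewrite pnatr_eq0 -lt0n.
have d0 : d%:R != 0 :> R by rewrite pnatr_eq0 -lt0n.
rewrite natrM; field.
by rewrite s0 N0 d0.
Qed.
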